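(* Let $\Gamma=(N,A,\hat I,\prec,\hat\chi,\gamma,u)$ be a spacetime game with perfect information. For each agent $i\in N$, let $\sigma'_i$ be a reduced strategy of agent $i$, and let $\sigma'=\bigcup_{i\in N}\sigma'_i$ be the corresponding reduced strategy profile. Then there exists a unique complete history of $\Gamma$ that is a restriction of $\sigma'$. Consequently, a game in normal form can be built on the reduced strategy spaces, assigning to each reduced strategy profile the payoffs of this complete history (the reduced strategic form of $\Gamma$).
   Context: Minkowski spacetime is $\mathbb{R}^d$ ($d\ge 2$, usually $d=4$) with a flat metric of signature $(d-1,1)$; write its points as $(x,t)$ with $x\in\mathbb{R}^{d-1}$, $t\in\mathbb{R}$ (units with speed of light 1). A raw assignment is a partial function $\alpha$ from $\hat I$ to $A$ with $\alpha(P)\in\hat\chi(P)$ wherever it is defined; $\alpha(P)=\perp$ means undefined at $P$. A raw assignment $\alpha$ is a restriction of $\beta$ (and $\beta$ an extension of $\alpha$) if $\alpha(P)\ne\perp$ implies $\alpha(P)=\beta(P)$, for all $P$. A spacetime game with perfect information is a tuple $\Gamma=(N,A,\hat I,\prec,\hat\chi,\gamma,u)$ where: - $N$ is a set of agents and $A$ a set of actions; - $\hat I$ is a finite set of decision points $\hat I_{i,j}$, where $i\in N$ is the agent deciding at $\hat I_{i,j}$ and $j\in\mathbb{N}$ is an index; each has a location $\mathcal{L}(\hat I_{i,j})\in\mathbb{R}^d$; - $\prec$ (timelike precedence) is the relation induced by the locations: for decision points $P,Q$ with locations $(x_P,t_P)$ and $(x_Q,t_Q)$, $P\prec Q$ iff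 the locations are different and $t_Q-t_P\ge\|x_Q-x_P\|$ (lightlike separation counts as timelike; colocated points count as spacelike-separated); - $\hat\chi:\hat I\to\mathcal{P}(A)$ gives the actions available at each decision point; - $\gamma$ associates with each decision point $P$ its contingency coordinates $\gamma_P$ (written $\gamma_{i,j}$ for $P=\hat I_{i,j}$), a raw assignment defined only on decision points $Q\prec P$. Say that $Q$ actually precedes $P$ if $Q\prec P$ and $\gamma_Q$ is a restriction of $\gamma_P$. The contingency coordinates are required to be consistent: for all $P,Q\in\hat I$, $\gamma_P(Q)\neq\perp$ if and only if $Q$ actually precedes $P$; - $u$ assigns a real number (payoff) to each agent and complete history, where complete histories are defined next. A history is a raw assignment $h$ such that for all decision points $P,Q$: if $h(P)\ne\perp$ and $\gamma_P(Q)\neq\perp$ then $h(Q)=\gamma_P(Q)$. A history is complete if no history that assigns actions to strictly more decision points extends it; otherwise it is incomplete. A strategy of agent $i$ is a raw assignment defined exactly on the decision points $(\hat I_{i,j})_j$ of agent $i$. Given a strategy $s_i$ of agent $i$, a decision point $\hat I_{i,j}$ of agent $i$ is not actual (for $s_i$) if its contingency coordinates conflict with $s_i$ at some other decision point $\hat I_{i,k}$ of the same agent, i.e. $\gamma_{i,j}(\hat I_{i,k})\ne\perp$ and $\gamma_{i,j}(\hat I_{i,k})\neq s_i(\hat I_{i,k})$. Two strategies of agent $i$ are equivalent if they differ only at decision points that are not actual. The (canonical) reduced strategy of an equivalence class is obtained from a strategy in the class by un-assigning all decision points that are not actual; it is thus a restriction of the original strategy. A reduced strategy profile is the union (as partial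 functions) of one reduced strategy for each agent. *)

(* Defs.v *)
From mathcomp Require Import all_boot all_order all_algebra.
From mathcomp Require Import boolp classical_sets reals.

Set Implicit Arguments.
Unset Strict Implicit.
Unset Printing Implicit Defensive.

Import Order.TTheory GRing.Theory Num.Theory.
Local Open Scope ring_scope.

(* A point (x, t) of R^d, with x in R^(d-1).  Only meaningful for d >= 1. *)
Definition spacetime (R : realType) (d : nat) : Type := ('rV[R]_d.-1 * R)%type.

(* The Euclidean norm; the library norm on matrices is the sup norm. *)
Definition enorm (R : realType) (n : nat) (x : 'rV[R]_n) : R :=
  Num.sqrt (\sum_(i < n) x 0 i ^+ 2).

Definition timelike_precedes (R : realType) (d : nat) (p q : spacetime R d) :
    Prop :=
  p <> q /\ enorm (q.1 - p.1) <= q.2 - p.2.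

Definition induced_prec (R : realType) (d : nat) (I : Type)
    (loc : I -> spacetime R d) (P Q : I) : Prop :=
  timelike_precedes (loc P) (loc Q).

(* Partial functions; [None] encodes "undefined". *)
Definition partial (I : finType) (A : Type) : Type := {ffun I -> option A}.

Definition restriction (I : finType) (A : Type) (a b : partial I A) : Prop :=
  forall P, a P <> None -> a P = b P.

Definition dom (I : finType) (A : Type) (a : partial I A) : {set I} :=
  [set P | isSome (a P)].

Definition raw_assignment (I : finType) (A : Type) (chi : I -> set A)
    (a : partial I A) : Prop :=
  forall P x, a P = Some x -> chi P x.

Definition actually_precedes (I : finType) (A : Type) (prec : I -> I -> Prop)
    (gamma : I -> partial I A) (Q P : I) : Prop :=
  prec Q P /\ restriction (gamma Q) (gamma P).

(* A spacetime game without its payoffs, which are indexed by the complete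
   histories.  The decision point \hat I_(i,j) is the P with
   agent_of P = i and index_of P = j. *)
Record game_form (R : realType) (d : nat) := GameForm {
  agent : Type;
  action : Type;
  decision_point : finType;
  agent_of : decision_point -> agent;
  index_of : decision_point -> nat;
  label_inj : injective (fun P => (agent_of P, index_of P));
  location : decision_point -> spacetime R d;
  available : decision_point -> set action;
  contingency : decision_point -> partial decision_point action;
  contingency_raw : forall P, raw_assignment available (contingency P);
  contingency_dom : forall P Q,
    contingency P Q <> None -> induced_prec location Q P;
  contingency_consistent : forall P Q,
    contingency P Q <> None <->
    actually_precedes (induced_prec location) contingency Q P
}.

Definition assignment (R : realType) (d : nat) (G : game_form R d) : Type :=
  partial (decision_point G) (action G).

Definition history (R : realType) (d : nat) (G : game_form R d)
    (h : assignment G) : Prop :=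
  raw_assignment (@available R d G) h /\
  forall P Q : decision_point G,
    h P <> None -> contingency P Q <> None -> h Q = contingency P Q.

Definition complete_history (R : realType) (d : nat) (G : game_form R d)
    (h : assignment G) : Prop :=
  history h /\
  ~ exists k : assignment G,
      [/\ history k, restriction h k & dom h \proper dom k].

Record spacetime_game (R : realType) (d : nat) := SpacetimeGame {
  form :> game_form R d;
  payoff : agent form -> {h : assignment form | complete_history h} -> R
}.

Definition strategy (R : realType) (d : nat) (G : game_form R d)
    (i : agent G) (s : assignment G) : Prop :=
  raw_assignment (@available R d G) s /\
  forall P : decision_point G, s P <> None <-> agent_of P = i.

Definition not_actual (R : realType) (d : nat) (G : game_form R d)
    (i : agent G) (s : assignment G) (P : decision_point G) : Prop :=
  agent_of P = i /\
  exists Q : decision_point G, [/\ agent_of Q = i, Q <> P,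
    contingency P Q <> None & contingency P Q <> s Q].

Definition strategy_equiv (R : realType) (d : nat) (G : game_form R d)
    (i : agent G) (s s' : assignment G) : Prop :=
  forall P : decision_point G, s P <> s' P -> 
    not_actual i s P /\ not_actual i s' P.

Definition strategy_class (R : realType) (d : nat) (G : game_form R d)
    (i : agent G) (s : assignment G) : set (assignment G) :=
  fun s' => strategy i s' /\ strategy_equiv i s s'.

Definition unassign_not_actual (R : realType) (d : nat) (G : game_form R d)
    (i : agent G) (s : assignment G) : assignment G :=
  [ffun P => if `[< not_actual i s P >] then None else s P].

Definition reduced_strategy_of (R : realType) (d : nat) (G : game_form R d)
    (i : agent G) (C : set (assignment G)) (r : assignment G) : Prop :=
  exists2 s : assignment G, C s & r = unassign_not_actual i s.

Definition reduced_strategy (R : realType) (d : nat) (G : game_form R d)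
    (i : agent G) (r : assignment G) : Prop :=
  exists2 s : assignment G,
    strategy i s & reduced_strategy_of i (strategy_class i s) r.

Definition reduced_strategy_space (R : realType) (d : nat) (G : game_form R d)
    (i : agent G) : Type :=
  {r : assignment G | reduced_strategy i r}.

(* The union of the (domain-disjoint) partial functions s i: only the strategy
   of the agent deciding at P can be defined at P; see [profile_unionP]. *)
Definition profile_union (R : realType) (d : nat) (G : game_form R d)
    (s : forall i : agent G, reduced_strategy_space i) : assignment G :=
  [ffun P => sval (s (agent_of P)) P].

Lemma profile_unionP (R : realType) (d : nat) (G : game_form R d)
    (s : forall i : agent G, reduced_strategy_space i)
    (P : decision_point G) (a : action G) :
  profile_union s P = Some a <-> exists i, sval (s i) P = Some a.
Proof.
rewrite ffunE; split=> [sPa|[i sPa]]; first by exists (agent_of P).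
suff -> : agent_of P = i by [].
have [s0 _ [s1 [[_ dom1] _] r_def]] := svalP (s i).
by apply/dom1; move: sPa; rewrite r_def ffunE; case: ifP => // _ ->.
Qed.

Record normal_form_game (R : realType) (N : Type) (S : N -> Type) :=
  NormalFormGame { nf_payoff : N -> (forall i, S i) -> R }.

Definition reduced_strategic_form (R : realType) (d : nat)
    (G : spacetime_game R d)
    (F : normal_form_game R (@reduced_strategy_space R d G)) : Prop :=
  forall (s : forall i : agent G, reduced_strategy_space i)
         (h : {h : assignment G | complete_history h}),
    restriction (sval h) (profile_union s) ->
    forall i : agent G, nf_payoff F i s = payoff i h.

(* Main.v *)
(** The histories that are restrictions of a reduced profile [sigma] are closed
    under union, so there is at most one complete one.  For existence, take such
    a history [h] of maximal domain.  If a history [k] properly extended [h],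
    let [P] be an earliest decision point in [dom k] outside [dom h]: the
    contingency coordinates of [P] all agree with [h], hence with the underlying
    strategies, so [P] is actual and [sigma] is defined at [P]; adding
    [sigma P] to [h] contradicts maximality. *)
Require Import Defs.
From mathcomp Require Import all_boot all_order all_algebra.
From mathcomp Require Import boolp classical_sets reals.

Set Implicit Arguments.
Unset Strict Implicit.
Unset Printing Implicit Defensive.

Import Order.TTheory GRing.Theory Num.Theory.

Lemma enorm_le0 (R : realType) (n : nat) (x : 'rV[R]_n) :
  (enorm x <= 0)%R -> x = 0%R.
Proof.
rewrite /enorm => x_le0; apply/rowP => i; rewrite mxE.
have sq_ge0 (j : 'I_n) : true -> (0 <= x ord0 j ^+ 2)%R by rewrite sqr_ge0.
have : (Num.sqrt (\sum_(j < n) x ord0 j ^+ 2) == 0)%R.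
  by rewrite eq_le x_le0 sqrtr_ge0.
rewrite sqrtr_eq0 => sum_le0.
have /eqP : (\sum_(j < n) x ord0 j ^+ 2 == 0)%R.
  by rewrite eq_le sum_le0 sumr_ge0.
by move=> /(psumr_eq0P sq_ge0)/(_ i isT)/eqP; rewrite sqrf_eq0 => /eqP.
Qed.

(** At equal times the spatial distance would be at most 0, so the points would coincide. Time thus
    serves as a strict rank on decision points. *)
Lemma timelike_precedes_lt (R : realType) (d : nat) (p q : spacetime R d) :
  timelike_precedes p q -> (p.2 < q.2)%R.
Proof.
case: p q => [x t] [y u] [/= neq_pq le_xy].
have le_tu : (t <= u)%R.
  by rewrite -subr_ge0; apply: le_trans le_xy; exact: sqrtr_ge0.
rewrite lt_neqAle le_tu andbT; apply/eqP => eq_tu; apply: neq_pq.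
move: le_xy; rewrite eq_tu subrr => /enorm_le0 /eqP.
by rewrite subr_eq0 => /eqP ->.
Qed.

Section PartialFunctions.
Variables (I : finType) (A : Type).
Implicit Types a b c : partial I A.

Lemma in_dom a P : (P \in dom a) <-> a P <> None.
Proof. by rewrite inE; case: (a P). Qed.

Lemma restriction_subset_dom a b : restriction a b -> dom a \subset dom b.
Proof.
by move=> ab; apply/fintype.subsetP => P /in_dom aP; apply/in_dom; rewrite -ab.
Qed.

Lemma restriction_eq_dom a b : restriction a b -> dom b \subset dom a -> a = b.
Proof.
move=> ab /fintype.subsetP dom_ba; apply/ffunP => P.
have [bP|/in_dom/dom_ba/in_dom/ab //] := pselect (b P = None).
by apply: contrapT => abP; case: (abP); apply: ab; rewrite -bP.
Qed.

(** The bias towards [a] is harmless: the union is only taken of two restrictions of a common [c],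
    which agree wherever both are defined. *)
Definition partial_union a b : partial I A :=
  [ffun P => if a P is Some x then Some x else b P].

Lemma restriction_unionl a b : restriction a (partial_union a b).
Proof. by move=> P; rewrite ffunE; case: (a P). Qed.

Lemma restriction_unionr a b c :
  restriction a c -> restriction b c -> restriction b (partial_union a b).
Proof.
move=> ac bc P bP; rewrite ffunE; case aP: (a P) => [x|//].
by rewrite bc // -aP ac // aP.
Qed.

Definition partial_update a (P : I) (v : option A) : partial I A :=
  [ffun Q => if Q == P then v else a Q].

Lemma dom_proper_update a P v :
  a P = None -> v <> None -> dom a \proper dom (partial_update a P v).
Proof.
move=> aP vN; apply/fintype.properP; split.
  apply/fintype.subsetP => Q /in_dom aQ; apply/in_dom; rewrite ffunE.
  by case: eqP => // _.
by exists P; [apply/in_dom; rewrite ffunE eqxx | apply/negP => /in_dom].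
Qed.

End PartialFunctions.

Section Histories.
Variables (R : realType) (d : nat) (G : game_form R d).
Implicit Types h k : assignment G.

Lemma contingency_lt (P Q : decision_point G) :
  contingency P Q <> None -> ((location Q).2 < (location P).2)%R.
Proof. by move/contingency_dom/timelike_precedes_lt. Qed.

Lemma history_union h k c :
  restriction h c -> restriction k c -> history h -> history k ->
  history (partial_union h k).
Proof.
move=> hc kc [h_raw h_hist] [k_raw k_hist]; split=> [P x|P Q].
  by rewrite ffunE; case hP: (h P) => [y|]; [rewrite -hP => /h_raw|exact: k_raw].
have [hP _ PQ|] := pselect (h P <> None).
  by rewrite -(h_hist P Q hP PQ) -restriction_unionl // (h_hist P).
move=> /contrapT hP; rewrite ffunE hP => kP PQ.
by rewrite -(k_hist P Q kP PQ) -(restriction_unionr hc kc) // (k_hist P).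
Qed.

Lemma history_update h (P : decision_point G) (v : option (action G)) :
  history h -> h P = None -> (forall x, v = Some x -> available P x) ->
  (forall Q, contingency P Q <> None -> h Q = contingency P Q) ->
  history (partial_update h P v).
Proof.
move=> [h_raw h_hist] hP v_raw P_act; split=> [Q x|Q S].
  by rewrite ffunE; case: eqP => [->|_]; [exact: v_raw|exact: h_raw].
rewrite !ffunE; case: (eqVneq Q P) => [-> _ PS|_ hQ QS].
  (* At [P] itself: [P] is not among its own contingency coordinates, since time would have to
     increase strictly. *)
  by case: eqP PS => [-> /contingency_lt|_ /P_act //]; rewrite ltxx.
(* At another point [Q]: if its coordinates involved [P], then [h], being defined at [Q], would
   already be defined at [P]. *)
by case: eqP QS (h_hist _ _ hQ QS) => [->|//]; rewrite hP => QP /esym/QP.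
Qed.

Lemma complete_history_unique h k c :
  restriction h c -> restriction k c -> complete_history h ->
  complete_history k -> h = k.
Proof.
have eq_union h' k' : restriction h' (partial_union h k) ->
    history (partial_union h k) -> complete_history h' ->
    h' = partial_union h k.
  move=> sub_u hist_u [_ h'_max]; apply: restriction_eq_dom => //.
  apply: contrapT => /negP not_sub; apply: h'_max.
  exists (partial_union h k); split=> //.
  by rewrite properE restriction_subset_dom.
move=> hc kc h_compl k_compl.
have hist_u := history_union hc kc h_compl.1 k_compl.1.
rewrite [LHS](eq_union h k) //; last exact: restriction_unionl.
by apply/esym/eq_union => //; exact: restriction_unionr hc kc.
Qed.

(** Maximality only concerns restrictions of [c], whereas completeness must exclude every extension
    [k], even one in conflict with [c]. So [k] only serves to locate a point [P]; the action added
    there is [c P]. *)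
Lemma maximal_history_complete h c :
  raw_assignment (@available R d G) c ->
  (forall P, (forall Q, contingency P Q <> None -> c Q = contingency P Q) ->
     c P <> None) ->
  history h -> restriction h c ->
  (forall k, history k -> restriction k c -> #|dom k| <= #|dom h|) ->
  complete_history h.
Proof.
move=> c_raw c_act h_hist hc h_max; split=> // -[k [k_hist hk]].
move=> /fintype.properP [_ [P0 kP0 hP0]].
pose new := [pred P | (P \notin dom h) && (P \in dom k)].
have P0_new : new P0 by rewrite /= hP0.
case: (Order.TotalTheory.arg_minP (fun P => (location P).2) P0_new).
move=> P /= /andP[/negP hP /in_dom kP] P_min.
have {}hP : h P = None by apply: contrapT => /in_dom.
(* As [k] is defined at [P], it is defined at [Q]; since [Q] is earlier than [P], minimality puts
   [Q] in [dom h], where [h] and [k] agree. *)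
have P_act Q : contingency P Q <> None -> h Q = contingency P Q.
  move=> PQ; have kQ := k_hist.2 _ _ kP PQ; rewrite -kQ.
  apply: hk; apply/in_dom; apply/negPn/negP => hQ.
  have /P_min : new Q by rewrite /= hQ; apply/in_dom; rewrite kQ.
  by rewrite leNgt contingency_lt.
have cP : c P <> None.
  by apply: c_act => Q PQ; rewrite -(P_act Q PQ) hc // P_act.
have := proper_card (dom_proper_update hP cP).
rewrite ltnNge h_max //; first by apply: history_update => // x /c_raw.
by move=> Q; rewrite ffunE; case: eqP => [->|_ /hc].
Qed.

(** The empty history restricts any [c], and domain sizes are bounded by the number of decision
    points. *)
Lemma maximal_history_exists c :
  exists h, [/\ history h, restriction h c &
    forall k, history k -> restriction k c -> #|dom k| <= #|dom h|].
Proof.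
pose attained n :=
  `[< exists h, [/\ history h, restriction h c & #|dom h| = n] >].
have attained0 : exists n, attained n.
  pose h0 : assignment G := [ffun=> None].
  exists #|dom h0|; apply/asboolP; exists h0; split=> //.
    by split=> [P x|P Q]; rewrite ffunE.
  by move=> P; rewrite ffunE.
have attained_le n : attained n -> n <= #|decision_point G|.
  by move=> /asboolP [h [_ _ <-]]; exact: max_card.
case: (ex_maxnP attained0 attained_le) => n /asboolP [h [h_hist hc <-]] n_max.
by exists h; split=> // k k_hist kc; apply: n_max; apply/asboolP; exists k.
Qed.

Variable s : forall i : agent G, reduced_strategy_space i.

(** This gives access to a strategy defined at all points of agent [i]: the class member whose
    reduction is the component of [s] at [i]. *)
Lemma profile_union_underlying (i : agent G) : exists s0 : assignment G,
  strategy i s0 /\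
  forall P, agent_of P = i ->
    profile_union s P = if `[< not_actual i s0 P >] then None else s0 P.
Proof.
have [s0 _ [s1 [s1_strat _] r_def]] := svalP (s i).
by exists s1; split=> // P Pi; rewrite ffunE Pi r_def ffunE.
Qed.

Lemma profile_union_raw : raw_assignment (@available R d G) (profile_union s).
Proof.
move=> P x; have [s0 [[s0_raw _] ->//]] := profile_union_underlying (agent_of P).
by case: ifP => // _ /s0_raw.
Qed.

Lemma profile_union_defined (P : decision_point G) :
  (forall Q, contingency P Q <> None ->
     profile_union s Q = contingency P Q) ->
  profile_union s P <> None.
Proof.
move=> P_act.
have [s0 [[_ s0_dom] s0E]] := profile_union_underlying (agent_of P).
rewrite s0E //; case: asboolP => [[_ [Q [Qi _ PQ]]]|_]; last exact/s0_dom.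
(* A conflict of [P] with [s0] at [Q] is impossible: the profile is defined at [Q], hence equals
   [s0 Q] there, and it also equals [contingency P Q]. *)
by move: (PQ); rewrite -P_act // s0E //; case: ifP.
Qed.

Lemma complete_history_exists_unique : exists! h : assignment G,
  complete_history h /\ restriction h (profile_union s).
Proof.
have [h [h_hist hc h_max]] := maximal_history_exists (profile_union s).
have h_compl : complete_history h.
  by apply: maximal_history_complete hc h_max => //;
    [exact: profile_union_raw | exact: profile_union_defined].
exists h; split=> // k [k_compl kc].
exact: complete_history_unique hc kc h_compl k_compl.
Qed.

End Histories.

Theorem theorem2 (R : realType) (d : nat) (hd : (2 <= d)%N)
    (G : spacetime_game R d) :
  (forall s : (forall i : agent G, reduced_strategy_space i),
     exists! h : assignment G,
       complete_history h /\ restriction h (profile_union s)) /\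
  (exists F : normal_form_game R (@reduced_strategy_space R d G),
     reduced_strategic_form F).
Proof.
split=> [s|]; first exact: complete_history_exists_unique.
pose outcome s := cid (@complete_history_exists_unique R d G s).
exists (NormalFormGame (fun i s =>
  payoff i (exist _ (sval (outcome s)) (svalP (outcome s)).1.1))).
move=> s [h h_compl] /= hs i; congr (payoff i _).
(* Payoffs take a history bundled with its completeness proof; uniqueness of the history suffices to
   identify the bundles. *)
by apply: eq_exist; apply: (svalP (outcome s)).2.
Qed.
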